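(* Let $\mathcal{R}$ be a TRS over a signature $\Sigma$, and let $\mathcal{P}\subseteq \mathit{DP}(\mathcal{R})$ be such that $\mathcal{R}\cup\mathcal{P}$ is a right-linear overlay system. Then there exists no infinite minimal $(\mathcal{P},\mathcal{R})$-chain if and only if there exists no infinite innermost minimal $(\mathcal{P},\mathcal{R})$-chain.
   Context: A rule $\ell\to r$ is right-linear if no variable occurs more than once in $r$. A TRS has an inner-overlap if there are rules $\ell\to r$, $\ell'\to r'$ (variables renamed apart) such that some proper non-variable subterm of $\ell$ is unifiable with $\ell'$; it is an overlay system if it has no inner-overlap. Defined symbols of $\mathcal{R}$ are root symbols of left-hand sides; for each defined symbol $f$ there is a fresh tuple symbol $f^\#$ of the same arity, and for $t=f(t_1,\dots,t_n)$ with $f$ defined, $t^\#=f^\#(t_1,\dots,t_n)$. For each rule $\ell\to r\in\mathcal{R}$ and each subterm $t$ of $r$ whose root is a defined symbol, $\ell^\#\to t^\#$ is a dependency pair; $\mathit{DP}(\mathcal{R})$ is the set of all of them. A term is terminating w.r.t. $\mathcal{R}$ if no infinite $\mathcal{R}$-rewrite sequence starts from it. $\to_{\varepsilon,\mathcal{P}}$ denotes a rewrite step with a rule of $\mathcal{P}$ at the root position, $\to_{>\varepsilon,\mathcal{R}}$ a rewrite step with a rule of $\mathcal{R}$ below the root. A $(\mathcal{P},\mathcal{R})$-chain is a (possibly infinite) sequence $t_0\to^*_{>\varepsilon,\mathcal{R}} s_1\to_{\varepsilon,\mathcal{P}} t_1\to^*_{>\varepsilon,\mathcal{R}} s_2\to_{\varepsilon,\mathcal{P}}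 t_2\to^*_{>\varepsilon,\mathcal{R}}\cdots$; it is minimal if all proper subterms of all $t_0,t_1,t_2,\dots$ are terminating w.r.t. $\mathcal{R}$. It is innermost if for all $i\ge 0$, the steps $t_i\to^*_{>\varepsilon,\mathcal{R}}s_{i+1}$ are innermost $\mathcal{R}$-steps (each contracted redex has only $\mathcal{R}$-normal-form proper subterms) and the root step $s_{i+1}\to_{\varepsilon,\mathcal{P}} t_{i+1}$ is innermost w.r.t. $\mathcal{P}\cup\mathcal{R}$ (all proper subterms of $s_{i+1}$ are normal forms of $\mathcal{P}\cup\mathcal{R}$). *)

(* Defs.v *)
From Stdlib Require Import Relation_Definitions Relation_Operators.
From mathcomp Require Import all_boot.
From mathcomp Require Import boolp classical_sets.

Set Implicit Arguments.
Unset Strict Implicit.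
Unset Printing Implicit Defensive.

Local Open Scope classical_set_scope.

Record signature := Signature { sym :> Type; arity : sym -> nat }.
Arguments arity {s} f.

(** Variables are natural numbers; arguments are finite functions, so that
    every term respects arities and Leibniz equality is syntactic equality. *)
Inductive term (S : signature) : Type :=
  | Var of nat
  | Fun (f : S) of {ffun 'I_(arity f) -> term S}.
Arguments Var {S} x.
Arguments Fun {S} f a.

Definition rule (S : signature) : Type := (term S * term S)%type.

Section Terms.
Variable S : signature.
Implicit Types (t u v l r : term S) (x : nat).

Fixpoint subst (s : nat -> term S) t : term S :=
  match t with
  | Var x => s x
  | Fun f a => Fun f [ffun i => subst s (a i)]
  end.

Definition rename (rho : nat -> nat) : term S -> term S :=
  subst (fun x => Var (rho x)).

Fixpoint occ x t : nat :=
  match t with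
  | Var y => x == y
  | Fun f a => \sum_(i < arity f) occ x (a i)
  end.

Definition vars t : set nat := [set x | 0 < occ x t].

Inductive subterm u : term S -> Prop :=
  | subterm_refl : subterm u u
  | subterm_arg f (a : {ffun 'I_(arity f) -> term S}) i :
      subterm u (a i) -> subterm u (Fun f a).

Inductive proper_subterm u : term S -> Prop :=
  | proper_subterm_arg f (a : {ffun 'I_(arity f) -> term S}) i :
      subterm u (a i) -> proper_subterm u (Fun f a).

Definition is_var t : Prop := exists x, t = Var x.

Definition unifiable t u : Prop := exists s, subst s t = subst s u.

Definition is_trs (R : set (rule S)) : Prop :=
  forall l r, R (l, r) -> ~ is_var l /\ vars r `<=` vars l.

Definition right_linear (R : set (rule S)) : Prop :=
  forall l r, R (l, r) -> forall x, occ x r <= 1.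

(** The two rules may coincide; [rho] renames the second one apart. *)
Definition inner_overlap (R : set (rule S)) : Prop :=
  exists l r l' r' u (rho : nat -> nat),
    [/\ R (l, r), R (l', r'),
        proper_subterm u l /\ ~ is_var u,
        injective rho /\ vars l `&` vars (rename rho l') = set0
      & unifiable u (rename rho l')].

Definition overlay (R : set (rule S)) : Prop := ~ inner_overlap R.

Definition root_step (R : set (rule S)) : relation (term S) :=
  fun t u => exists l r s, [/\ R (l, r), t = subst s l & u = subst s r].

Inductive below_root (E : relation (term S)) : relation (term S) :=
  | below_root_arg f (a : {ffun 'I_(arity f) -> term S}) i u :
      E (a i) u ->
      below_root E (Fun f a) (Fun f [ffun j => if j == i then u else a j]).

Inductive ctx_closure (E : relation (term S)) : relation (term S) :=
  | ctx_root t u : E t u -> ctx_closure E t u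
  | ctx_arg f (a : {ffun 'I_(arity f) -> term S}) i u :
      ctx_closure E (a i) u ->
      ctx_closure E (Fun f a) (Fun f [ffun j => if j == i then u else a j]).

Definition step (R : set (rule S)) : relation (term S) :=
  ctx_closure (root_step R).

Definition normal_form (R : set (rule S)) t : Prop := forall u, ~ step R t u.

(** Root step with a rule of [P], innermost with respect to [Q]. *)
Definition innermost_root_step (P Q : set (rule S)) : relation (term S) :=
  fun t u =>
    root_step P t u /\ forall v, proper_subterm v t -> normal_form Q v.

Definition innermost_step (R : set (rule S)) : relation (term S) :=
  ctx_closure (innermost_root_step R R).

Definition terminating (R : set (rule S)) t : Prop :=
  ~ exists c : nat -> term S, c 0 = t /\ forall i, step R (c i) (c i.+1).

(** Infinite chains [t 0 ->* s 1 -> t 1 ->* s 2 -> t 2 ...];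
    [s 0] is a dummy entry. *)
Definition inf_chain (P R : set (rule S)) (t s : nat -> term S) : Prop :=
  forall i, clos_refl_trans _ (below_root (step R)) (t i) (s i.+1) /\
            root_step P (s i.+1) (t i.+1).

Definition minimal (R : set (rule S)) (t : nat -> term S) : Prop :=
  forall i u, proper_subterm u (t i) -> terminating R u.

Definition innermost_inf_chain (P R : set (rule S)) (t s : nat -> term S) :
    Prop :=
  forall i, clos_refl_trans _ (below_root (innermost_step R)) (t i) (s i.+1) /\
            innermost_root_step P (P `|` R) (s i.+1) (t i.+1).

End Terms.

Section DependencyPairs.
Variables (S : signature) (R : set (rule S)).

Definition defined (f : S) : Prop := exists a r, R (Fun f a, r).

(** Tuple symbols: one for each defined symbol.  The boolean reflection makes
    membership proof-irrelevant, so that no tuple symbol is duplicated. *)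
Definition tuple_sym : Type := {f : S | `[< defined f >]}.

Definition sharp_sig : signature :=
  @Signature (S + tuple_sym)
    (fun f => match f with inl f => arity f | inr f => arity (sval f) end).

Fixpoint emb (t : term S) : term sharp_sig :=
  match t with
  | Var x => Var x
  | Fun f a => @Fun sharp_sig (inl f) [ffun i => emb (a i)]
  end.

Definition emb_trs : set (rule sharp_sig) :=
  [set (emb p.1, emb p.2) | p in R].

(** [sharp f a] is the marked version of the term [Fun (sval f) a]. *)
Definition sharp (f : tuple_sym) (a : {ffun 'I_(arity (sval f)) -> term S}) :
    term sharp_sig :=
  @Fun sharp_sig (inr f) [ffun i => emb (a i)].

Definition DP : set (rule sharp_sig) :=
  [set p | exists (f g : tuple_sym) a b r,
     [/\ R (Fun (sval f) a, r), subterm (Fun (sval g) b) r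
       & p = (@sharp f a, @sharp g b)]].

End DependencyPairs.
Arguments sharp_sig {S} R.
Arguments emb {S} R t.
Arguments emb_trs {S} R.
Arguments sharp {S R} f a.
Arguments DP {S} R.

(* Main.v *)
Require Import Defs.
From mathcomp Require Import all_boot.
From mathcomp Require Import boolp classical_sets.
From Stdlib Require Import Relation_Definitions Relation_Operators Operators_Properties.
From Stdlib Require Import Eqdep Transitive_Closure.

(** Let [nf] be a fixed innermost normalization, normalizing arguments first.
    In an overlay system instances of non-variable proper subterms of left-hand
    sides are never redexes, so root steps [l s -> r s] survive normalization of [s].  Start from
    an infinite minimal chain, and before each root step reduce the arguments as
    far as possible while the term still starts an infinite minimal chain (the
    arguments are terminating).  Consider then a segment [l s -> r s ->* v].
    Any reduction in it of material copied from [s] could, [r] being linear, be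
    performed on [s] before the root step; by the choice of [l s] there is none.
    Hence [r (nf s)] rewrites innermost to [v] with its arguments replaced by
    their [nf], and normalizing the whole chain makes it innermost for [R].
    Tuple symbols nested in arguments could still form redexes of [P]; after one
    step they only occur in normal forms, so such subterms can be abstracted into
    variables. *)

Set Implicit Arguments.
Unset Strict Implicit.
Unset Printing Implicit Defensive.

Local Open Scope classical_set_scope.

(** * Reflexive-transitive closures and strong normalization of abstract relations *)

Local Notation rt := (clos_refl_trans _).

Lemma rt1nP A (E : relation A) x y : clos_refl_trans_1n _ E x y <-> rt E x y.
Proof. by rewrite clos_rt_rt1n_iff. Qed.

Lemma rt_map A B (E : relation A) (F : relation B) (h : A -> B) :
  (forall x y, E x y -> rt F (h x) (h y)) ->
  forall x y, rt E x y -> rt F (h x) (h y).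
Proof.
move=> hEF x y; elim=> {x y} [x y /hEF //|x|x y z _ hxy _ hyz].
  exact: rt_refl.
exact: rt_trans hxy hyz.
Qed.

Lemma rt_sub A (E F : relation A) :
  (forall x y, E x y -> F x y) -> forall x y, rt E x y -> rt F x y.
Proof. by move=> EF; apply: (rt_map (h := id)) => x y /EF; apply: rt_step. Qed.

Lemma rt_preserve A (E : relation A) (Q : A -> Prop) :
  (forall x y, E x y -> Q x -> Q y) -> forall x y, rt E x y -> Q x -> Q y.
Proof. by move=> EQ x y; elim=> {x y} [x y /EQ //|//|x y z _ h1 _ h2 /h1]. Qed.

Lemma rt_t_neq A (E : relation A) x y : rt E x y -> x <> y -> clos_trans _ E x y.
Proof.
rewrite clos_rt_rtn1_iff; case=> [//|z w zw]; rewrite -clos_rt_rtn1_iff => xz _.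
exact: clos_rt_t xz (t_step _ _ _ _ zw).
Qed.

(** Dependent choice from ordinary choice: successors are chosen on all of [A], with a dummy value
    outside [Q], and iterated from [x0]. *)
Lemma dep_choice A (Q : A -> Prop) (E : relation A) x0 :
  Q x0 -> (forall x, Q x -> exists2 y, Q y & E x y) ->
  exists s : nat -> A, [/\ s 0 = x0, forall n, Q (s n) & forall n, E (s n) (s n.+1)].
Proof.
move=> Qx0 next.
have /choice[f fP] : forall x, exists y, Q x -> Q y /\ E x y.
  move=> x; case: (pselect (Q x)) => [/next[y Qy xy]|nQ]; first by exists y.
  by exists x.
have Qs n : Q (iter n f x0) by elim: n => [//|n /fP[]].
exists (fun n => iter n f x0); split=> // n.
by have [] := fP _ (Qs n).
Qed.

(** [SN (step R)] is convertible to [terminating R]; the general form also serves transitive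
    closures and unions with the subterm relation. *)
Definition SN A (E : relation A) x : Prop :=
  ~ exists c : nat -> A, c 0 = x /\ forall i, E (c i) (c i.+1).

(** Gives access to well-founded induction. A non-accessible element has a non-accessible successor,
    so dependent choice yields an infinite sequence. *)
Lemma SN_Acc A (E : relation A) x : SN E x <-> Acc (fun y x => E x y) x.
Proof.
split=> [SNx|]; last first.
  elim=> {}x _ IH [c [c0 cE]]; apply: (IH (c 1)); first by rewrite -c0.
  by exists (fun i => c i.+1).
apply: contrapT => nAcc; apply: SNx.
have [|c [c0 _ cE]] := @dep_choice A (fun x => ~ Acc (fun y x => E x y) x) E x nAcc;
  last by exists c.
move=> {nAcc}x nAcc; apply: contrapT => nex; apply: nAcc; constructor=> y xy.
by apply: contrapT => nAccy; apply: nex; exists y.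
Qed.

Lemma SN_intro A (E : relation A) x : (forall y, E x y -> SN E y) -> SN E x.
Proof. by move=> xP; apply/SN_Acc; constructor=> y /xP/SN_Acc. Qed.

Lemma SN_step A (E : relation A) x y : E x y -> SN E x -> SN E y.
Proof. by move=> xy /SN_Acc[xP]; apply/SN_Acc/xP. Qed.

Lemma SN_ind A (E : relation A) (Q : A -> Prop) :
  (forall x, SN E x -> (forall y, E x y -> Q y) -> Q x) ->
  forall x, SN E x -> Q x.
Proof.
move=> QE x SNx; have /SN_Acc xP := SNx; elim: xP SNx => {}x _ IH SNx.
by apply: QE => // y xy; apply: IH => //; apply: SN_step xy SNx.
Qed.

Lemma SN_rt A (E : relation A) x y : rt E x y -> SN E x -> SN E y.
Proof. by apply: rt_preserve => {}x {}y; apply: SN_step. Qed.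

Lemma SN_trans A (E : relation A) x : SN E x -> SN (clos_trans _ E) x.
Proof.
move=> /SN_Acc xP; apply/SN_Acc; have {xP} := Acc_clos_trans _ _ _ xP.
elim=> {}x _ IH; constructor=> y xy; apply: IH.
by elim: xy => {x y} [x y xy|x y z _ xy _ yz]; [apply: t_step|apply: t_trans yz xy].
Qed.

(** Coordinates are minimised one after the other. Minimality below [k] survives later changes,
    since reducts of a reduct of [b] are reducts of [b]. *)
Lemma SN_ffun_minimal A (E : relation A) n (Q : {ffun 'I_n -> A} -> Prop)
    (a : {ffun 'I_n -> A}) :
  (forall i, SN E (a i)) -> Q a ->
  exists b : {ffun 'I_n -> A}, [/\ forall i, rt E (a i) (b i), Q b
    & forall c : {ffun 'I_n -> A}, (forall i, rt E (b i) (c i)) -> Q c -> c = b].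
Proof.
move=> SNa Qa.
suff H k : k <= n -> exists b : {ffun 'I_n -> A}, [/\ forall i, rt E (a i) (b i), Q b
    & forall c : {ffun 'I_n -> A}, (forall i, rt E (b i) (c i)) -> Q c ->
      forall i : 'I_n, i < k -> c i = b i].
  have [b [ab Qb bmin]] := H n (leqnn n).
  by exists b; split=> // c bc Qc; apply/ffunP => i; apply: bmin.
elim: k => [_|k IH kn]; first by exists a; split=> // i; apply: rt_refl.
have [b [ab Qb bmin]] := IH (ltnW kn); pose j := Ordinal kn.
(* The transitive closure is needed because reaching [Q] again may take several steps at [j]. *)
have SNb : SN (clos_trans _ E) (b j) by apply: SN_trans; apply: SN_rt (ab j) (SNa j).
move e: (b j) SNb => x SNx; move: x SNx b e ab Qb bmin.
apply: SN_ind => x _ IHx b e ab Qb bmin.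
case: (pselect (exists c : {ffun 'I_n -> A},
    [/\ forall i, rt E (b i) (c i), Q c & c j <> b j])) => [[c [bc Qc cj]]|nc].
  have ac i : rt E (a i) (c i) := rt_trans _ _ _ _ _ (ab i) (bc i).
  apply: (IHx (c j) _ c erefl ac Qc).
    by rewrite -e; apply: rt_t_neq (bc j) (nesym cj).
  move=> d cd Qd i ik; have bd i' := rt_trans _ _ _ _ _ (bc i') (cd i').
  by rewrite (bmin c bc Qc i ik) (bmin d bd Qd i ik).
exists b; split=> // c bc Qc i.
rewrite ltnS leq_eqVlt => /orP[/eqP ik|]; last exact: bmin.
have -> : i = j by apply: val_inj.
by apply: contrapT => cj; apply: nc; exists c.
Qed.

(** * Terms, substitutions, subterms and closure under contexts *)

Section Terms.
Variable S : signature.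
Implicit Types (t u v l r : term S) (x : nat) (s : nat -> term S) (E : relation (term S)).

Lemma term_ind' (Q : term S -> Prop) :
  (forall x, Q (Var x)) ->
  (forall f (a : {ffun 'I_(arity f) -> term S}), (forall i, Q (a i)) -> Q (Fun f a)) ->
  forall t, Q t.
Proof. by move=> QV QF; fix IH 1; case=> [//|f a]; apply: QF => i; apply: IH. Qed.

Lemma Fun_inj f (a b : {ffun 'I_(arity f) -> term S}) : Fun f a = Fun f b -> a = b.
Proof. by case=> e; apply: inj_pair2 e. Qed.

Lemma subst_ext s1 s2 t :
  (forall x, vars t x -> s1 x = s2 x) -> subst s1 t = subst s2 t.
Proof.
elim/term_ind': t => [x|f a IH] eqs /=; first by apply: eqs; rewrite /vars /= eqxx.
congr Fun; apply/ffunP => i; rewrite !ffunE; apply: IH => x xa; apply: eqs.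
by rewrite /vars /= (bigD1 i) //= addn_gt0 xa.
Qed.

Lemma subst_vars s1 s2 t x : subst s1 t = subst s2 t -> vars t x -> s1 x = s2 x.
Proof.
elim/term_ind': t => [y|f a IH] /=; rewrite /vars /=.
  by move=> e; case: eqP => // ->.
move=> /Fun_inj/ffunP e; rewrite lt0n sum_nat_eq0 negb_forall => /existsP[i /=].
by rewrite -lt0n; apply: IH; have := e i; rewrite !ffunE.
Qed.

Lemma vars_arg f (a : {ffun 'I_(arity f) -> term S}) x :
  vars (Fun f a) x <-> exists i, vars (a i) x.
Proof.
rewrite /vars /=; split=> [|[i xi]]; last by rewrite (bigD1 i) //= addn_gt0 xi.
rewrite lt0n sum_nat_eq0 negb_forall => /existsP[i /=].
by rewrite -lt0n; exists i.
Qed.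

Lemma vars_subterm t u : subterm u t -> vars u `<=` vars t.
Proof. by elim=> {t} [//|f a i _ IH x /IH xi]; apply/vars_arg; exists i. Qed.

Lemma vars_bound t : exists m, forall x, vars t x -> x < m.
Proof.
elim/term_ind': t => [y|f a /choice[m mP]].
  by exists y.+1 => x; rewrite /vars /=; case: eqP => // ->.
exists (\max_i m i) => x /vars_arg[i /mP xm].
exact: leq_trans xm (leq_bigmax i).
Qed.

Lemma subst_comp s1 s2 t : subst s1 (subst s2 t) = subst (fun x => subst s1 (s2 x)) t.
Proof.
elim/term_ind': t => [//|f a IH] /=.
by congr Fun; apply/ffunP => i; rewrite !ffunE.
Qed.

Lemma subterm_trans u v t : subterm u v -> subterm v t -> subterm u t.
Proof. by move=> uv; elim=> {t} [//|f a i _]; apply: subterm_arg. Qed.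

Lemma subterm_proper u t : proper_subterm u t -> subterm u t.
Proof. by case=> f a i; apply: subterm_arg. Qed.

Lemma subterm_proper_trans u v t :
  subterm u v -> proper_subterm v t -> proper_subterm u t.
Proof. by move=> uv; case=> f a i /(subterm_trans uv); apply: proper_subterm_arg. Qed.

Lemma proper_subterm_inv u f (a : {ffun 'I_(arity f) -> term S}) :
  proper_subterm u (Fun f a) -> exists i, subterm u (a i).
Proof.
move e: (Fun f a) => t ut; case: ut e => g b i ui [gf]; subst g.
by move=> e; rewrite (inj_pair2 _ _ _ _ _ e); exists i.
Qed.

Lemma subterm_inv u t : subterm u t -> u = t \/ proper_subterm u t.
Proof. by case=> [|f a i ui]; [left|right; apply: proper_subterm_arg ui]. Qed.

Lemma subst_var_subterm s t x : vars t x -> subterm (s x) (subst s t).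
Proof.
elim/term_ind': t => [y|f a IH].
  by rewrite /vars /=; case: eqP => // ->; constructor.
by move=> /vars_arg[i /IH xi] /=; apply: subterm_arg (i) _; rewrite ffunE.
Qed.

Lemma subterm_subst s u v : subterm u v -> subterm (subst s u) (subst s v).
Proof.
elim=> {v} [|f a i _ IH] /=; first exact: subterm_refl.
by apply: subterm_arg (i) _; rewrite ffunE.
Qed.

Lemma proper_subterm_subst s u v :
  proper_subterm u v -> proper_subterm (subst s u) (subst s v).
Proof.
case=> f a i /(subterm_subst s) ui /=.
by apply: proper_subterm_arg (i) _; rewrite ffunE.
Qed.

(** The argument tuple in the conclusions of [below_root_arg] and [ctx_arg], given a name. *)
Definition upd (f : S) (a : {ffun 'I_(arity f) -> term S}) i u :
    {ffun 'I_(arity f) -> term S} :=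
  [ffun j => if j == i then u else a j].

Lemma below_root_inv E f (a : {ffun 'I_(arity f) -> term S}) u :
  below_root E (Fun f a) u -> exists i v, E (a i) v /\ u = Fun f (upd a i v).
Proof.
move e: (Fun f a) => t tu; case: tu e => g b i v biv [gf]; subst g.
by move=> e; rewrite (inj_pair2 _ _ _ _ _ e); exists i, v.
Qed.

Lemma ctx_closureP E t u :
  ctx_closure E t u <-> E t u \/ below_root (ctx_closure E) t u.
Proof.
split; first by case=> [v w|f a i v]; [left|right].
by case=> [|[f a i v]]; [apply: ctx_root|apply: ctx_arg].
Qed.

Lemma below_ctx E t u : below_root (ctx_closure E) t u -> ctx_closure E t u.
Proof. by move=> tu; apply/ctx_closureP; right. Qed.

Lemma below_root_sub (E F : relation (term S)) t u :
  (forall t u, E t u -> F t u) -> below_root E t u -> below_root F t u.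
Proof. by move=> EF; case=> f a i v /EF; constructor. Qed.

Lemma ctx_sub (E F : relation (term S)) t u :
  (forall t u, E t u -> F t u) -> ctx_closure E t u -> ctx_closure F t u.
Proof.
by move=> EF; elim=> {t u} [t u /EF|f a i u _]; [apply: ctx_root|apply: ctx_arg].
Qed.

Lemma rt_below_inv E f (a : {ffun 'I_(arity f) -> term S}) u :
  rt (below_root E) (Fun f a) u ->
  exists b : {ffun 'I_(arity f) -> term S}, u = Fun f b /\ forall i, rt E (a i) (b i).
Proof.
move=> /rt1nP; move e: (Fun f a) => t tu; elim: tu a e => {t u} [t|t v u].
  by move=> a <-; exists a; split=> // i; apply: rt_refl.
move=> tv _ IH a e; subst t; have [i [w [aw ev]]] := below_root_inv tv.
have [b [-> wb]] := IH _ (esym ev); exists b; split=> // j.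
move: (wb j); rewrite ffunE; case: eqP => // -> h.
exact: rt_trans (rt_step _ _ _ _ aw) h.
Qed.

Lemma rt_arg E f (a : {ffun 'I_(arity f) -> term S}) i u :
  rt E (a i) u -> rt (below_root E) (Fun f a) (Fun f (upd a i u)).
Proof.
have {2}-> : a = upd a i (a i).
  by apply/ffunP => j; rewrite ffunE; case: eqP => [->|].
apply: (rt_map (h := fun v => Fun f (upd a i v))) => v w vw; apply: rt_step.
have -> : upd a i w = upd (upd a i v) i w.
  by apply/ffunP => j; rewrite !ffunE; case: eqP.
by constructor; rewrite ffunE eqxx.
Qed.

Lemma rt_args E f (a b : {ffun 'I_(arity f) -> term S}) :
  (forall i, rt E (a i) (b i)) -> rt (below_root E) (Fun f a) (Fun f b).
Proof.
(* Arguments are reduced from left to right; in [c k] the first [k] are done. *)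
move=> ab; pose c k : {ffun 'I_(arity f) -> term S} :=
  [ffun i : 'I__ => if i < k then b i else a i].
have abk k : k <= arity f -> rt (below_root E) (Fun f a) (Fun f (c k)).
  elim: k => [_|k IH kn].
    have -> : c 0 = a by apply/ffunP => i; rewrite ffunE.
    exact: rt_refl.
  apply: rt_trans (IH (ltnW kn)) _; pose i := Ordinal kn.
  have -> : c k.+1 = upd (c k) i (b i).
    apply/ffunP => j; rewrite !ffunE ltnS leq_eqVlt -val_eqE /=.
    by case: eqP => //= jk; congr (b _); apply: val_inj.
  by apply: rt_arg; rewrite ffunE ltnn.
have -> : b = c (arity f) by apply/ffunP => i; rewrite ffunE ltn_ord.
exact: abk.
Qed.

Lemma rt_args_ctx E f (a b : {ffun 'I_(arity f) -> term S}) :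
  (forall i, rt (ctx_closure E) (a i) (b i)) ->
  rt (ctx_closure E) (Fun f a) (Fun f b).
Proof. by move=> /rt_args; apply: rt_sub => t u; apply: below_ctx. Qed.

Lemma rt_subst E s1 s2 t :
  (forall x, vars t x -> rt (ctx_closure E) (s1 x) (s2 x)) ->
  rt (ctx_closure E) (subst s1 t) (subst s2 t).
Proof.
elim/term_ind': t => [x|f a IH] s12 /=; first by apply: s12; rewrite /vars /= eqxx.
apply: rt_args_ctx => i; rewrite !ffunE; apply: IH => x xi.
by apply: s12; apply/vars_arg; exists i.
Qed.

(** The reduction is cut at its first root step; all earlier steps act inside arguments. *)
Lemma rt_ctx_inv E f (a : {ffun 'I_(arity f) -> term S}) u :
  rt (ctx_closure E) (Fun f a) u ->
  exists b : {ffun 'I_(arity f) -> term S},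
    (forall i, rt (ctx_closure E) (a i) (b i)) /\
    (u = Fun f b \/ exists2 v, E (Fun f b) v & rt (ctx_closure E) v u).
Proof.
move=> /rt1nP; move e: (Fun f a) => t tu; elim: tu a e => {t u} [t|t v u].
  by move=> a <-; exists a; split; [move=> i; apply: rt_refl|left].
move=> tv /rt1nP vu IH a e; subst t; case/ctx_closureP: tv => [av|].
  by exists a; split=> [i|]; [apply: rt_refl|right; exists v].
move=> /below_root_inv[i [w [aw ev]]].
have [b [wb ub]] := IH _ (esym ev); exists b; split=> // j.
move: (wb j); rewrite ffunE; case: eqP => // -> h.
exact: rt_trans (rt_step _ _ _ _ aw) h.
Qed.

Lemma subterm_ctx E t u u' : subterm u t -> ctx_closure E u u' ->
  exists2 t', ctx_closure E t t' & subterm u' t'.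
Proof.
elim=> {t} [|f a i _ IH] uu'; first by exists u'; [|constructor].
have [v av uv] := IH uu'; exists (Fun f (upd a i v)); first exact: ctx_arg.
by apply: subterm_arg (i) _; rewrite ffunE eqxx.
Qed.

(** Its transitive closure is the induction order of [rt_prenormalizes], which passes both to
    arguments and to contracta. *)
Definition step_or_arg E t u : Prop := ctx_closure E t u \/ proper_subterm u t.

(** Proved for all subterms [u] of [t] at once: a step in [u] lifts to a step of [t], covered by the
    outer induction, while a proper subterm of [u] is covered by structural induction. *)
Lemma SN_step_or_arg E t : SN (ctx_closure E) t -> SN (step_or_arg E) t.
Proof.
move=> SNt; suff : forall u, subterm u t -> SN (step_or_arg E) u by apply; constructor.
move: t SNt; apply: SN_ind => t _ IH.
elim/term_ind' => [x|f a IHa] ut; apply: SN_intro => v.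
  case=> [xv|xv]; last by inversion xv.
  by have [t' tt' vt'] := subterm_ctx ut xv; apply: IH tt' _ vt'.
case=> [av|/proper_subterm_inv[i vi]].
  by have [t' tt' vt'] := subterm_ctx ut av; apply: IH tt' _ vt'.
have ait : subterm (a i) t.
  by apply: subterm_trans ut; apply: subterm_arg (i) _; constructor.
have SNi := IHa i ait.
by case/subterm_inv: vi => [-> //|vp]; apply: SN_step SNi; right.
Qed.

Lemma SN_subterm E t u : SN (ctx_closure E) t -> subterm u t -> SN (ctx_closure E) u.
Proof.
move=> SNt; move: t SNt u; apply: SN_ind => t _ IH u ut.
apply: SN_intro => u' uu'.
by have [t' tt' ut'] := subterm_ctx ut uu'; apply: IH tt' _ ut'.
Qed.

Definition args_SN E t : Prop := forall u, proper_subterm u t -> SN (ctx_closure E) u.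

Lemma args_SN_Fun E f (a : {ffun 'I_(arity f) -> term S}) :
  args_SN E (Fun f a) <-> forall i, SN (ctx_closure E) (a i).
Proof.
split=> [SNa i|SNa u /proper_subterm_inv[i ui]]; last exact: SN_subterm (SNa i) ui.
by apply: SNa; apply: proper_subterm_arg (i) _; constructor.
Qed.

Lemma args_SN_rt E t u :
  rt (below_root (ctx_closure E)) t u -> args_SN E t -> args_SN E u.
Proof.
apply: rt_preserve => {}t {}u; case=> f a i v av /args_SN_Fun SNa.
apply/args_SN_Fun => j; rewrite ffunE; case: eqP => // _.
exact: SN_step av (SNa i).
Qed.

Lemma minimalP (R : set (rule S)) (t : nat -> term S) :
  minimal R t <-> forall i, args_SN (root_step R) (t i).
Proof. by []. Qed.

Lemma normal_subterm (R : set (rule S)) t u :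
  normal_form R t -> subterm u t -> normal_form R u.
Proof. by move=> nt ut v uv; have [t' /nt] := subterm_ctx ut uv. Qed.

Lemma normal_args (R : set (rule S)) f (a : {ffun 'I_(arity f) -> term S}) u :
  (forall i, normal_form R (a i)) -> proper_subterm u (Fun f a) -> normal_form R u.
Proof. by move=> na /proper_subterm_inv[i ui]; apply: normal_subterm (na i) ui. Qed.

Lemma normal_rt (R : set (rule S)) t u :
  normal_form R t -> rt (innermost_step R) t u -> u = t.
Proof.
move=> nt /rt1nP tu; case: tu nt => // v w tv _ nt; case: (nt v).
by apply: ctx_sub tv => ? ? [].
Qed.

Lemma innermost_step_step (R : set (rule S)) t u : innermost_step R t u -> step R t u.
Proof. by apply: ctx_sub => ? ? []. Qed.

Lemma not_normal_innermost (R : set (rule S)) t :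
  ~ normal_form R t -> exists u, innermost_step R t u.
Proof.
elim/term_ind': t => [x|f a IH] nt.
  (* Rules are arbitrary here, so a variable may be a redex; having no proper subterms, it is an
     innermost one. *)
  have [u /ctx_closureP[xu|xu]] : exists u, step R (Var x) u.
    by apply: contrapT => nex; apply: nt => u xu; apply: nex; exists u.
    by exists u; apply: ctx_root; split=> // v xv; inversion xv.
  by inversion xu.
case: (pselect (exists i, ~ normal_form R (a i))) => [[i /IH[u aiu]]|na].
  by exists (Fun f (upd a i u)); apply: ctx_arg.
have {}na i : normal_form R (a i) by apply: contrapT => ni; apply: na; exists i.
have [u /ctx_closureP[au|]] : exists u, step R (Fun f a) u.
  by apply: contrapT => nex; apply: nt => u xu; apply: nex; exists u.
  by exists u; apply: ctx_root; split=> // v; apply: normal_args.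
by move=> /below_root_inv[i [v [/na]]].
Qed.

Lemma root_step_subst (R : set (rule S)) s t u :
  root_step R t u -> root_step R (subst s t) (subst s u).
Proof.
move=> [l [r [s' [lr -> ->]]]]; exists l, r, (fun x => subst s (s' x)).
by rewrite !subst_comp.
Qed.

Lemma ctx_subst E s t u :
  (forall t u, E t u -> E (subst s t) (subst s u)) ->
  ctx_closure E t u -> ctx_closure E (subst s t) (subst s u).
Proof.
move=> sE; elim=> {t u} [t u /sE|f a i u _ IH] /=; first exact: ctx_root.
set b := [ffun i => subst s (a i)].
have -> : [ffun j => subst s ([ffun j => if j == i then u else a j] j)] =
    upd b i (subst s u).
  by apply/ffunP => j; rewrite !ffunE; case: eqP.
by apply: ctx_arg; rewrite ffunE.
Qed.

End Terms.

(** * Innermost normal forms of terminating terms *)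

Section Normalization.
Variables (S : signature) (R : set (rule S)).
Implicit Types (t u v l r : term S) (x : nat) (s : nat -> term S).

Local Notation SNR := (SN (step R)).

Lemma SN_innermost_nf t : SNR t ->
  exists u, rt (innermost_step R) t u /\ normal_form R u.
Proof.
move: t; apply: SN_ind => t _ IH; case: (pselect (normal_form R t)) => [nt|].
  by exists t; split=> //; apply: rt_refl.
move=> /not_normal_innermost[u tu]; have [v [uv nv]] := IH u (innermost_step_step tu).
by exists v; split=> //; apply: rt_trans (rt_step _ _ _ _ tu) uv.
Qed.

(** Rules may overlap at the root, so innermost normal forms need not be unique and one is chosen.
    The value [t] is a default when there is none. *)
Definition some_nf t : term S :=
  if pselect (exists u, rt (innermost_step R) t u /\ normal_form R u) is left e
  then projT1 (cid e) else t.

(** Normalizing the arguments before the whole term makes [nf] commute with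
    substitution into any term that stays irreducible. *)
Fixpoint nf t : term S :=
  match t with
  | Var x => some_nf (Var x)
  | Fun f a => some_nf (Fun f [ffun i => nf (a i)])
  end.

Lemma some_nfP t : SNR t ->
  rt (innermost_step R) t (some_nf t) /\ normal_form R (some_nf t).
Proof.
by move=> /SN_innermost_nf; rewrite /some_nf; case: pselect => // e _; case: (cid e).
Qed.

Lemma some_nf_normal t : normal_form R t -> some_nf t = t.
Proof.
move=> nt; rewrite /some_nf; case: pselect => // e; case: (cid e) => u [tu _] /=.
exact: normal_rt tu.
Qed.

Lemma nfP t : SNR t -> rt (innermost_step R) t (nf t) /\ normal_form R (nf t).
Proof.
elim/term_ind': t => [x|f a IH] SNt; first exact: some_nfP.
have {}IH i : rt (innermost_step R) (a i) (nf (a i)).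
  apply: (IH i _).1; apply: SN_subterm SNt _; apply: subterm_arg (i) _.
  exact: subterm_refl.
have aa : rt (innermost_step R) (Fun f a) (Fun f [ffun i => nf (a i)]).
  by apply: rt_args_ctx => i; rewrite ffunE.
have [|h1 h2] := @some_nfP (Fun f [ffun i => nf (a i)]).
  by apply: SN_rt SNt; apply: rt_sub aa => ? ?; apply: innermost_step_step.
by split=> //; apply: rt_trans aa h1.
Qed.

Lemma nf_rt t : SNR t -> rt (innermost_step R) t (nf t).
Proof. by move=> /nfP[]. Qed.

Lemma nf_normal t : SNR t -> normal_form R (nf t).
Proof. by move=> /nfP[]. Qed.

Lemma nf_args_rt f (a : {ffun 'I_(arity f) -> term S}) : SNR (Fun f a) ->
  rt (innermost_step R) (Fun f [ffun i => nf (a i)]) (nf (Fun f a)).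
Proof.
move=> SNt; apply: (some_nfP _).1; apply: (SN_rt _ SNt); apply: rt_args_ctx => i.
rewrite ffunE; apply: rt_sub (nf_rt _) => [? ?|]; first exact: innermost_step_step.
by apply: SN_subterm SNt _; apply: subterm_arg (i) _; apply: subterm_refl.
Qed.

End Normalization.

(** * Normalizing reductions in a right-linear overlay system *)

Section Overlay.
Variables (S : signature) (R P : set (rule S)).
Hypothesis trs : is_trs (R `|` P).
Hypothesis rlin : right_linear (R `|` P).
Hypothesis over : overlay (R `|` P).
Hypothesis rhs_P : forall l r, P (l, r) -> ~ is_var r.
Implicit Types (t u v l r : term S) (x : nat) (s : nat -> term S).

Local Notation SNR := (SN (step R)).
Local Notation nf := (nf R).
Local Notation inn := (innermost_step R).

Lemma not_var t : ~ is_var t -> exists f a, t = @Fun S f a.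
Proof. by case: t => [x []|f a _]; [exists x|exists f, a]. Qed.

Lemma overlay_no_root_step l r u s v :
  (R `|` P) (l, r) -> proper_subterm u l -> ~ is_var u ->
  ~ root_step (R `|` P) (subst s u) v.
Proof.
move=> lr ul nvu [l' [r' [s' [lr' uE _]]]].
have [m mP] := vars_bound l.
(* Shifting by the bound [m] renames the second rule apart, so the two substitutions can be glued
   into a unifier. *)
pose s2 x := if x < m then s x else s' (x - m).
apply: over; exists l, r, l', r', u, (addn^~ m); split=> //.
  split; first exact: addIn.
  apply/seteqP; split=> // x [/mP xm].
  suff : forall t, vars (rename (addn^~ m) t) x -> m <= x.
    by move=> /[apply]; rewrite leqNgt xm.
  elim/term_ind' => [y|f a IH]; rewrite /rename /=.
    by rewrite /vars /=; case: eqP => // ->; rewrite leq_addl.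
  by move=> /vars_arg[i]; rewrite ffunE; apply: IH.
exists s2; rewrite /rename subst_comp.
have -> : subst s2 u = subst s u.
  apply: subst_ext => x xu; rewrite /s2 mP //.
  exact: vars_subterm (subterm_proper ul) _ xu.
by rewrite uE; apply: subst_ext => x _ /=; rewrite /s2 addnK ltnNge leq_addl.
Qed.

(** Once its arguments are normalised, the term is an instance of a non-variable proper subterm of
    [l]. It is therefore no redex, and the chosen normal form is the term itself. *)
Lemma nf_subst l r u s : (R `|` P) (l, r) -> proper_subterm u l ->
  SNR (subst s u) -> nf (subst s u) = subst (nf \o s) u.
Proof.
move=> lr; elim/term_ind': u => [//|f a IH] ul SNu.
have SNa i : SNR (subst s (a i)).
  apply: SN_subterm SNu _ => /=; apply: subterm_arg (i) _; rewrite ffunE.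
  exact: subterm_refl.
have nfa i : nf (subst s (a i)) = subst (nf \o s) (a i).
  apply: IH => //; apply: subterm_proper_trans ul; apply: subterm_arg (i) _.
  exact: subterm_refl.
have -> : subst (nf \o s) (Fun f a) = Fun f [ffun i => nf (subst s (a i))].
  by congr Fun; apply/ffunP => i; rewrite !ffunE nfa.
rewrite /=.
have -> : [ffun i => nf ([ffun i0 => subst s (a i0)] i)] = [ffun i => nf (subst s (a i))].
  by apply/ffunP => i; rewrite !ffunE.
apply: some_nf_normal => v /ctx_closureP[|/below_root_inv[i [w [iw _]]]]; last first.
  by move: iw; rewrite ffunE; apply: (nf_normal (SNa i)).
have -> : Fun f [ffun i => nf (subst s (a i))] = subst (nf \o s) (Fun f a).
  by congr Fun; apply/ffunP => i; rewrite !ffunE nfa.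
move=> [l' [r' [s' [lr' h1 h2]]]]; apply: (overlay_no_root_step lr ul).
  by case.
by exists l', r', s'; split; [left|exact: h1|exact: h2].
Qed.

Lemma nf_subst_lhs f (a : {ffun 'I_(arity f) -> term S}) r s :
  (R `|` P) (Fun f a, r) -> (forall i, SNR (subst s (a i))) ->
  subst (nf \o s) (Fun f a) = Fun f [ffun i => nf (subst s (a i))].
Proof.
move=> lr SNa; congr Fun; apply/ffunP => i; rewrite !ffunE (nf_subst lr) //.
by apply: proper_subterm_arg (i) _; apply: subterm_refl.
Qed.

Lemma normal_nf_args (f : S) (a : 'I_(arity f) -> term S) u :
  (forall i, SNR (a i)) -> proper_subterm u (Fun f [ffun i => nf (a i)]) ->
  normal_form R u.
Proof. by move=> SNa; apply: normal_args => i; rewrite ffunE; apply: nf_normal. Qed.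

(** [s'] absorbs the steps made in material copied from [s]; what then remains on the way to [u] has
    an innermost counterpart after normalization. *)
Definition prenormalizes r s u : Prop := exists s',
  [/\ forall x, rt (step R) (s x) (s' x), rt (step R) (subst s' r) u
    & rt inn (subst (nf \o s') r) (nf u)].

(** By linearity different arguments share no variable, so the substitutions found for them can be
    glued. *)
Lemma prenormalizes_args f (a b : {ffun 'I_(arity f) -> term S}) s :
  (forall x, occ x (Fun f a) <= 1) ->
  (forall i, prenormalizes (a i) s (b i)) ->
  exists s', [/\ forall x, rt (step R) (s x) (s' x),
    forall i, rt (step R) (subst s' (a i)) (b i)
    & forall i, rt inn (subst (nf \o s') (a i)) (nf (b i))].
Proof.
move=> lin /choice[s_ s_P].
(* [s' x] follows the only argument containing [x]; if there is none, it defaults to [s x]. *)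
pose s' x := if [pick i | 0 < occ x (a i)] is Some i then s_ i x else s x.
have s'E i x : vars (a i) x -> s' x = s_ i x.
  rewrite /vars /s' /= => xi; case: pickP => [j xj|/(_ i)]; last by rewrite xi.
  case: (eqVneq i j) => [-> //|ij]; move: (lin x) => /=.
  rewrite (bigD1 i) //= (bigD1 j) 1?eq_sym //=.
  by case: (occ x (a i)) xi => // m; case: (occ x (a j)) xj => // m'; rewrite addSn addnS.
exists s'; split=> [x|i|i].
- rewrite /s'; case: pickP => [i _|_]; last exact: rt_refl.
  by have [] := s_P i.
- by rewrite (subst_ext (s'E i)); have [] := s_P i.
rewrite (@subst_ext _ (nf \o s') (nf \o s_ i)) => [|x /s'E /= -> //].
by have [] := s_P i.
Qed.

(** [r] and [s] are quantified inside the induction on [t]: past a root step, the right-hand side of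
    the applied rule takes over the role of [r]. *)
Lemma rt_prenormalizes t : SNR t -> forall r s u,
  (forall x, occ x r <= 1) -> t = subst s r -> rt (step R) t u ->
  prenormalizes r s u.
Proof.
move=> SNt; have := SN_trans (SN_step_or_arg SNt); move=> SNt'.
move: t SNt' SNt; apply: SN_ind => t _ IH SNt; case=> [x|f a] s u lin tE tu.
  (* With [r] a variable, the whole reduction happens in copied material and is absorbed by [s']. *)
  exists (fun y => if y == x then u else s y); split=> [y||] /=; rewrite ?eqxx.
  - by case: eqP => [->|_]; [rewrite /= in tE; rewrite -tE|apply: rt_refl].
  - exact: rt_refl.
  exact: rt_refl.
pose c := [ffun i => subst s (a i)].
have {}tE : t = Fun f c by [].
have sub_c i : proper_subterm (c i) t.
  by rewrite tE; apply: proper_subterm_arg (i) _; apply: subterm_refl.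
have IHa (b : {ffun 'I_(arity f) -> term S}) :
    (forall i, rt (step R) (c i) (b i)) ->
    forall i, prenormalizes (a i) s (b i).
  move=> cb i.
  apply: (IH (c i)) => //.
  - by apply: t_step; right.
  - exact: SN_subterm SNt (subterm_proper (sub_c i)).
  - by move=> x; apply: leq_trans (lin x); rewrite /= (bigD1 i) //= leq_addr.
  by rewrite ffunE.
(* Without a root step the arguments suffice; otherwise [v] is the contractum of the first root
   step. *)
move: (tu); rewrite tE => /rt_ctx_inv[b [cb [uE|[v [l [r [s1 [lr bE vE]]]] vu]]]].
  have [s' [ss' s'b nfb]] := prenormalizes_args lin (IHa b cb).
  exists s'; split=> //=.
    by rewrite uE; apply: rt_args_ctx => i; rewrite ffunE.
  rewrite uE; apply: rt_trans (nf_args_rt _); last by rewrite -uE; apply: SN_rt tu SNt.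
  by apply: rt_args_ctx => i; rewrite !ffunE.
have [nvl _] : ~ is_var l /\ vars r `<=` vars l by apply: trs; left.
have tb : rt (step R) t (Fun f b) by rewrite tE; apply: rt_args_ctx.
have bv : step R (Fun f b) v by apply: ctx_root; exists l, r, s1.
have tv : clos_trans _ (step_or_arg (root_step R)) t v.
  apply: (clos_rt_t _ _ _ (Fun f b)); last by apply: t_step; left.
  by apply: rt_sub tb => ? ?; left.
have SNv : SNR v by apply: SN_rt SNt; apply: rt_trans tb (rt_step _ _ _ _ bv).
have linr x : occ x r <= 1 by apply: (rlin (l := l)); left.
have [s1' [ss1 s1'u nfu]] := IH v tv SNv r s1 u linr vE vu.
have [g [d lE]] := not_var nvl; subst l.
move: bE => /= bE; have gf : f = g by case: bE.
subst g; have {}bE := Fun_inj bE.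
(* The steps from [s1] to [s1'] are moved before the root step: the arguments are now reduced up to
   [b'], and the induction hypothesis is applied to these longer reductions. *)
pose b' := [ffun i => subst s1' (d i)].
have bb' i : rt (step R) (b i) (b' i).
  by rewrite bE !ffunE; apply: rt_subst.
have cb' i : rt (step R) (c i) (b' i) := rt_trans _ _ _ _ _ (cb i) (bb' i).
have [s' [ss' s'b' nfb']] := prenormalizes_args lin (IHa b' cb').
have root_b' : step R (Fun f b') (subst s1' r).
  by apply: ctx_root; exists (Fun f d), r, s1'.
have SNd i : SNR (subst s1' (d i)).
  by have := SN_rt (cb' i) (SN_subterm SNt (subterm_proper (sub_c i))); rewrite ffunE.
exists s'; split=> //=.
  apply: rt_trans s1'u; apply: rt_trans (rt_step _ _ _ _ root_b').
  by apply: rt_args_ctx => i; rewrite ffunE.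
have nf_b' : subst (nf \o s1') (Fun f d) = Fun f [ffun i => nf (subst s1' (d i))].
  by apply: (nf_subst_lhs (r := r)) => //; left.
(* The normalised arguments of [b'] form an instance of the same left-hand side, which is then an
   innermost redex; its contractum is the start of [nfu]. *)
apply: rt_trans nfu; apply: rt_trans (_ : rt inn _ (subst (nf \o s1') (Fun f d))) _.
  by rewrite nf_b'; apply: rt_args_ctx => i; have := nfb' i; rewrite !ffunE.
apply/rt_step/ctx_root; split; first by exists (Fun f d), r, (nf \o s1').
by rewrite nf_b' => v'; apply: normal_nf_args.
Qed.

(** * Minimal starting terms and the normalization of chains *)

Definition starts_chain t : Prop :=
  exists ts ss, [/\ inf_chain P R ts ss, minimal R ts & ts 0 = t].

Lemma starts_chain_args t : starts_chain t -> args_SN (root_step R) t.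
Proof. by move=> [ts [ss [_ /minimalP tsm <-]]]. Qed.

Lemma starts_chain_inv t : starts_chain t ->
  exists v t', [/\ rt (below_root (step R)) t v, root_step P v t' & starts_chain t'].
Proof.
move=> [ts [ss [tss /minimalP tsm <-]]]; have [h1 h2] := tss 0.
exists (ss 1), (ts 1); split=> //; exists (fun i => ts i.+1), (fun i => ss i.+1).
by split=> // i; exact: tsm i.+1.
Qed.

Lemma starts_chain_cons t v t' : args_SN (root_step R) t ->
  rt (below_root (step R)) t v -> root_step P v t' -> starts_chain t' ->
  starts_chain t.
Proof.
move=> SNt tv vt' [ts [ss [tss /minimalP tsm ts0]]].
exists (fun n => if n is n'.+1 then ts n' else t).
(* Entry 0 is the dummy, so [v] belongs at index 1 and the old entries from 1 on move up by one. *)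
exists (fun n => if n is n'.+2 then ss n'.+1 else v); split=> //.
  by case=> [|i]; [rewrite ts0|apply: tss].
by apply/minimalP; case.
Qed.

Lemma starts_chain_back t v : args_SN (root_step R) t ->
  rt (below_root (step R)) t v -> starts_chain v -> starts_chain t.
Proof.
move=> SNt tv /starts_chain_inv[w [t' [vw wt' t'c]]].
exact: starts_chain_cons SNt (rt_trans _ _ _ _ _ tv vw) wt' t'c.
Qed.

(** Not the minimality of chains: it says that the arguments cannot be reduced further without
    losing the ability to start a chain. *)
Definition chain_minimal t : Prop := starts_chain t /\
  forall v, rt (below_root (step R)) t v -> starts_chain v -> v = t.

Lemma starts_chain_not_var t : starts_chain t -> ~ is_var t.
Proof.
move=> /starts_chain_inv[v [t' [/rt1nP tv [l [r [s [lr vE _]]]] _]]] [x tE].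
rewrite tE in tv; case: tv vE => [lE|u w xu]; last by inversion xu.
have [] := trs (or_intror lr); rewrite /is_var; case: l lE {lr} => [y _ []|//].
by exists y.
Qed.

Lemma chain_minimal_exists t : starts_chain t ->
  exists2 v, rt (below_root (step R)) t v & chain_minimal v.
Proof.
move=> tc; have [f [a tE]] := not_var (starts_chain_not_var tc); subst t.
have /args_SN_Fun SNa := starts_chain_args tc.
have [b [ab bc bmin]] := SN_ffun_minimal (Q := fun b => starts_chain (Fun f b)) SNa tc.
exists (Fun f b); first exact: rt_args.
split=> // v /rt_below_inv[c [-> bc']] cc.
by rewrite (bmin c).
Qed.

(** The root is left alone because it has to remain a redex of [P]. *)
Definition nf_args t : term S :=
  match t with
  | Var x => Var x
  | Fun f a => Fun f [ffun i => nf (a i)]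
  end.

Definition chain_link v w : Prop := exists l r s,
  [/\ P (l, r), v = subst s l, starts_chain (subst s r)
    & rt (below_root (step R)) (subst s r) w].

(** The term reached just before the first root step still starts a chain, so by minimality it is
    [v] itself. *)
Lemma chain_link_exists v : chain_minimal v ->
  exists2 w, chain_minimal w & chain_link v w.
Proof.
move=> [vc vmin]; have [v' [t' [vv' v't' t'c]]] := starts_chain_inv vc.
have v'c : starts_chain v'.
  apply: (starts_chain_cons _ _ v't' t'c); last exact: rt_refl.
  exact: args_SN_rt vv' (starts_chain_args vc).
have := vmin _ vv' v'c; move=> v'E; subst v'.
have [l [r [s [lr vE t'E]]]] := v't'.
have [w t'w wmin] := chain_minimal_exists t'c.
by exists w => //; exists l, r, s; rewrite -t'E.
Qed.

(** If reducing [s] to the [s'] of [prenormalizes_args] changed the left-hand side, [v] would have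
    another reduct that starts a chain, against its minimality. *)
Lemma nf_chain_link v w : chain_minimal v -> chain_minimal w -> chain_link v w ->
  exists t, [/\ root_step P (nf_args v) t, args_SN (root_step R) t
    & rt (below_root inn) t (nf_args w)].
Proof.
move=> [vc vmin] [wc wmin] [l [r [s [lr vE rc rw]]]].
have [nvl rl] : ~ is_var l /\ vars r `<=` vars l by apply: trs; right.
have [f [a lE]] := not_var nvl; subst l.
have [g [c rE]] := not_var (rhs_P lr); subst r.
move: (rw) => /= /rt_below_inv[b [wE cb]].
have /args_SN_Fun SNc := starts_chain_args rc.
have linr x : occ x (Fun g c) <= 1 by apply: (rlin (l := Fun f a)); right.
have [|s' [ss' s'b nfb]] := @prenormalizes_args g c b s linr.
  move=> i; have := cb i; have := SNc i; rewrite ffunE => SNi cbi.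
  apply: rt_prenormalizes SNi _ _ _ _ (erefl) cbi => x.
  by apply: leq_trans (linr x); rewrite /= (bigD1 i) //= leq_addr.
have /args_SN_Fun SNa : args_SN (root_step R) (subst s (Fun f a)).
  by rewrite -vE; apply: starts_chain_args.
have aa' : rt (below_root (step R)) (subst s (Fun f a)) (subst s' (Fun f a)).
  by apply: rt_args => i; rewrite !ffunE; apply: rt_subst.
have cc' : rt (below_root (step R)) (subst s (Fun g c)) (subst s' (Fun g c)).
  by apply: rt_args => i; rewrite !ffunE; apply: rt_subst.
(* The instance under [s'] still reduces to [w], which starts a chain. *)
have c'c : starts_chain (subst s' (Fun g c)).
  apply: (starts_chain_back _ _ wc).
    exact: args_SN_rt cc' (starts_chain_args rc).
  by rewrite wE; apply: rt_args => i; rewrite ffunE.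
have s's : subst s' (Fun f a) = subst s (Fun f a).
  rewrite -vE; apply: vmin; first by rewrite vE.
  apply: starts_chain_cons (rt_refl _ _ _) _ c'c.
    by apply: args_SN_rt aa' _; rewrite -vE; apply: starts_chain_args.
  by exists (Fun f a), (Fun g c), s'.
(* Agreement on the left-hand side suffices, as the right-hand side has no other variables. *)
have nfs' : subst (nf \o s') (Fun g c) = subst (nf \o s) (Fun g c).
  by apply: subst_ext => x /rl xl /=; rewrite (subst_vars s's xl).
have cnf : rt (below_root inn) (subst (nf \o s) (Fun g c)) (nf_args w).
  by rewrite wE -nfs'; apply: rt_args => i; have := nfb i; rewrite !ffunE.
exists (subst (nf \o s) (Fun g c)); split=> //.
  exists (Fun f a), (Fun g c), (nf \o s); split=> //.
  rewrite vE (nf_subst_lhs (r := Fun g c)) //=; last first.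
  - by move=> i; have := SNa i; rewrite ffunE.
  - by right.
  by congr Fun; apply/ffunP => i; rewrite !ffunE.
apply: args_SN_rt (starts_chain_args rc).
apply: rt_args => i; rewrite !ffunE; apply: rt_subst => x xc.
apply: rt_sub (nf_rt _) => [? ?|]; first exact: innermost_step_step.
apply: SN_subterm (SNc i) _; rewrite ffunE.
exact: subst_var_subterm.
Qed.

(** Here [ss 0] is a genuine redex and no dummy: its normal arguments are used later to locate the
    tuple symbols of [t 0]. Normality is only with respect to [R]. *)
Lemma innermost_chain_exists t0 : starts_chain t0 ->
  exists t ss : nat -> term S, [/\ minimal R t,
      forall i, rt (below_root inn) (t i) (ss i.+1)
    & forall i, root_step P (ss i) (t i) /\
        forall u, proper_subterm u (ss i) -> normal_form R u].
Proof.
move=> /chain_minimal_exists[v0 _ v0min].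
have [v [_ vmin vlink]] := dep_choice v0min chain_link_exists.
have /choice[t tP] i := nf_chain_link (vmin i) (vmin i.+1) (vlink i).
exists t, (fun i => nf_args (v i)); split=> [|i|i].
- by apply/minimalP => i; have [] := tP i.
- by have [] := tP i.
split=> [|u]; first by have [] := tP i.
have := starts_chain_args (vmin i).1; case: (v i) => [x _ xu|f a]; first by inversion xu.
by move=> /args_SN_Fun SNa; apply: normal_nf_args.
Qed.

End Overlay.

(** * Marked terms and dependency pairs *)

Section Sharp.
Variables (S : signature) (R : set (rule S)) (P : set (rule (sharp_sig R))).
Hypothesis trsR : is_trs R.
Hypothesis PDP : P `<=` DP R.
Implicit Types (w l r : term S) (t u v : term (sharp_sig R)) (x : nat).

Local Notation emb := (emb R).
Local Notation ER := (emb_trs R).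
Local Notation inn := (innermost_step ER).

Lemma emb_subst s w : emb (subst s w) = subst (fun x => emb (s x)) (emb w).
Proof.
elim/term_ind': w => [//|f a IH] /=.
by congr Fun; apply/ffunP => i; rewrite !ffunE IH.
Qed.

Lemma vars_emb w : vars (emb w) = vars w.
Proof.
elim/term_ind': w => [//|f a IH]; apply/seteqP.
by split=> x /vars_arg[i xi]; apply/vars_arg; exists i; move: xi; rewrite ffunE IH.
Qed.

Lemma subterm_emb u w : subterm u (emb w) -> exists w', u = emb w'.
Proof.
elim/term_ind': w => [x|f a IH] /subterm_inv[->|up]; try by eexists.
  by inversion up.
by have [i] := proper_subterm_inv up; rewrite ffunE; apply: IH.
Qed.

Lemma emb_trs_vars t u : ER (t, u) -> ~ is_var t /\ vars u `<=` vars t.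
Proof.
move=> [[l0 r0] /trsR[nv rl] [<- <-]]; rewrite !vars_emb; split=> // -[x].
by case: l0 nv {rl} => // y []; exists y.
Qed.

Lemma vars_sharp (f : tuple_sym R) a : vars (sharp f a) = vars (Fun (sval f) a).
Proof.
apply/seteqP; split=> x /vars_arg[i xi]; apply/vars_arg; exists i; move: xi;
by rewrite ffunE vars_emb.
Qed.

Lemma DP_vars (f g : tuple_sym R) a b r :
  R (Fun (sval f) a, r) -> subterm (Fun (sval g) b) r ->
  vars (sharp g b) `<=` vars (sharp f a).
Proof.
move=> /trsR[_ rl] gr x; rewrite !vars_sharp => /(vars_subterm gr).
exact: rl.
Qed.

Lemma sharp_trs : is_trs (ER `|` P).
Proof.
move=> l r [/emb_trs_vars //|/PDP[f [g [a [b [r0 [fr gr [-> ->]]]]]]]].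
by split; [case|apply: DP_vars fr gr].
Qed.

Lemma sharp_rhs t u : P (t, u) -> ~ is_var u.
Proof. by move=> /PDP[f [g [a [b [r0 [_ _ [_ ->]]]]]]] []. Qed.

(** Left-hand sides in [P] are rooted by a tuple symbol, and an embedded term contains none. *)
Lemma emb_normal_union w : normal_form ER (emb w) -> normal_form (P `|` ER) (emb w).
Proof.
move=> nw v wv; suff : step ER (emb w) v by apply: nw.
move: wv; move e: (emb w) => t tv; elim: tv w e {nw} => {t v} [t v tv|f a i v _ IH] w e.
  case: tv => [l [r [s [[/PDP[f [g [a [b [r0 [_ _ [lE _]]]]]]]|lr] tE vE]]]].
    by move: tE; rewrite lE -e; case: w {e}.
  by apply: ctx_root; exists l, r, s.
have [w' wE] : exists w', a i = emb w'.
  apply: (@subterm_emb _ w); rewrite e; apply: subterm_arg (i) _.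
  exact: subterm_refl.
by apply: ctx_arg; apply: (IH w').
Qed.

(** [rho] replaces variables by pairwise distinct terms that rewrite steps of
    [R] can neither match nor change. *)
Record inert (rho : nat -> term (sharp_sig R)) : Prop := Inert {
  inert_inj : injective rho;
  inert_normal : forall x, normal_form ER (rho x);
  inert_root : forall x (f : S) a, rho x <> @Fun (sharp_sig R) (inl f) a }.

(** * Pulling rewrite steps back along an inert substitution *)

Section Inert.
Variable rho : nat -> term (sharp_sig R).
Hypothesis rhoP : inert rho.

Lemma inert_emb_inj w1 w2 :
  subst rho (emb w1) = subst rho (emb w2) -> w1 = w2.
Proof.
elim/term_ind': w1 w2 => [x|f a IH] [y|g b] /=.
- by move=> /(inert_inj rhoP) ->.
- by move=> /(inert_root rhoP).
- by move=> /esym/(inert_root rhoP).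
move=> e; have fg : f = g by case: e.
subst g; move/Fun_inj/ffunP: e => e; congr Fun; apply/ffunP => i; apply: IH.
by have := e i; rewrite !ffunE.
Qed.

(** A function symbol of [l] never meets the root of some [rho y], so matching stays inside [w]. *)
Lemma inert_match l w s x : subst s (emb l) = subst rho (emb w) -> vars l x ->
  exists w', s x = subst rho (emb w').
Proof.
elim/term_ind': l w => [y|f a IH] w /=.
  by move=> e; rewrite /vars /=; case: eqP => // ->; exists w.
case: w => [y /esym/(inert_root rhoP) //|g b] /= e.
have fg : f = g by case: e.
subst g; move/Fun_inj/ffunP: e => e /vars_arg[i]; apply: (IH i (b i)).
by have := e i; rewrite !ffunE.
Qed.

Lemma inert_choice (s : nat -> term (sharp_sig R)) (D : set nat) :
  (forall x, D x -> exists w, s x = subst rho (emb w)) ->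
  exists s' : nat -> term S, forall x, D x -> s x = subst rho (emb (s' x)).
Proof.
move=> sD; have /choice[s' s'E] x : exists w, D x -> s x = subst rho (emb w).
  case: (pselect (D x)) => [/sD[w wE]|nD]; first by exists w.
  by exists (Var 0).
by exists s'.
Qed.

Lemma inert_subst (s : nat -> term (sharp_sig R)) s' w :
  (forall x, vars w x -> s x = subst rho (emb (s' x))) ->
  subst s (emb w) = subst rho (emb (subst s' w)).
Proof.
move=> sE; rewrite emb_subst subst_comp; apply: subst_ext => x.
by rewrite vars_emb => /sE.
Qed.

Lemma inert_root_step w u : root_step ER (subst rho (emb w)) u ->
  exists2 w', root_step ER (emb w) (emb w') & u = subst rho (emb w').
Proof.
move=> [_ [_ [s [[[l r] lr [<- <-]] wE ->]]]] /=.
have [s' sE] := @inert_choice s (vars l) (fun x => inert_match (esym wE)).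
exists (subst s' r); last first.
  have [_ rl] := trsR lr.
  by apply: inert_subst => x /rl/sE.
exists (emb l), (emb r), (fun x => emb (s' x)); split; last exact: emb_subst.
  by exists (l, r).
(* Injectivity is what lets a repeated variable of [l] be matched after pulling back. *)
by rewrite -emb_subst (inert_emb_inj (etrans wE (inert_subst sE))).
Qed.

Lemma inert_reflects_normal v : normal_form ER (subst rho v) -> normal_form ER v.
Proof. by move=> nv u /(ctx_subst (@root_step_subst _ _ rho))/nv. Qed.

Lemma inert_innermost w u : inn (subst rho (emb w)) u ->
  exists2 w', inn (emb w) (emb w') & u = subst rho (emb w').
Proof.
elim/term_ind': w u => [x|f a IH] u.
  by move=> /innermost_step_step /(inert_normal rhoP).
move=> /ctx_closureP[[/inert_root_step[w' ww' ->] na]|].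
  exists w' => //; apply: ctx_root; split=> // v vw.
  by apply: inert_reflects_normal; apply: na; apply: proper_subterm_subst.
move=> /below_root_inv[i [v [av ->]]]; move: av; rewrite !ffunE => /IH[w' aw' ->].
exists (Fun f (upd a i w')) => /=.
  have -> : [ffun j => emb (upd a i w' j)] =
      upd (f := inl f : sharp_sig R) [ffun j => emb (a j)] i (emb w').
    by apply/ffunP => j; rewrite !ffunE; case: eqP.
  by apply: ctx_arg; rewrite ffunE.
by congr Fun; apply/ffunP => j; rewrite !ffunE; case: eqP.
Qed.

Lemma inert_below (f : tuple_sym R) a u :
  rt (below_root inn) (subst rho (sharp f a)) u ->
  exists2 b, rt (below_root inn) (sharp f a) (sharp f b) & u = subst rho (sharp f b).
Proof.
move=> /rt1nP; move e: (subst rho _) => t tu.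
elim: tu a e => {t u} [t|t v u tv _ IH] a e.
  by exists a => //; apply: rt_refl.
move: tv; rewrite -e => /below_root_inv[i [v' [av vE]]].
move: av; rewrite !ffunE => /inert_innermost[w aw v'E].
have [|b ab ->] := IH (upd a i w).
  by rewrite vE v'E; congr Fun; apply/ffunP => j; rewrite !ffunE; case: eqP.
exists b => //; apply: rt_trans ab; apply: rt_step.
have -> : sharp f (upd a i w) = @Fun (sharp_sig R) (inr f)
      (upd (f := inr f : sharp_sig R) [ffun j => emb (a j)] i (emb w)).
  by congr Fun; apply/ffunP => j; rewrite !ffunE; case: eqP.
by apply: below_root_arg; rewrite ffunE.
Qed.

Lemma inert_dp_step (f : tuple_sym R) a u :
  root_step P (subst rho (sharp f a)) u ->
  exists g b, root_step P (sharp f a) (sharp g b) /\ u = subst rho (sharp g b).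
Proof.
move=> [l [r [s [lr e ->]]]].
have [f' [g [a' [b [r0 [fr gr [lE rE]]]]]]] := PDP lr; subst l r.
have ff : f = f' by case: e.
subst f'; have /ffunP {}e := Fun_inj e.
have [x|s' sE] := @inert_choice s (vars (sharp f a')).
  rewrite vars_sharp => /vars_arg[i]; apply: (@inert_match _ (a i)).
  by have := e i; rewrite !ffunE.
exists g, [ffun i => subst s' (b i)].
have sharp_subst h (c : {ffun 'I_(arity (sval h)) -> term S}) :
    subst (fun x => emb (s' x)) (sharp h c) = @sharp _ R h [ffun i => subst s' (c i)].
  by congr Fun; apply/ffunP => i; rewrite !ffunE emb_subst.
split; last first.
  rewrite -sharp_subst subst_comp; apply: subst_ext => x xb.
  by rewrite sE //; apply: DP_vars fr gr _ xb.
exists (sharp f a'), (sharp g b), (fun x => emb (s' x)); split=> //.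
rewrite sharp_subst; congr Fun; apply/ffunP => i; rewrite !ffunE; congr emb.
apply: inert_emb_inj; rewrite -(@inert_subst s); first by have := e i; rewrite !ffunE.
by move=> x xi; apply: sE; rewrite vars_sharp; apply/vars_arg; exists i.
Qed.

End Inert.

(** * Abstracting nested tuple symbols into variables *)

(** Only the range has to grow; variables may be renumbered, which [extends_emb] repairs by a
    renaming. *)
Definition extends (rho rho' : nat -> term (sharp_sig R)) : Prop :=
  forall x, exists y, rho' y = rho x.

Lemma extends_emb rho rho' w :
  extends rho rho' -> exists w', subst rho' (emb w') = subst rho (emb w).
Proof.
move=> /choice[h hE]; exists (rename h w).
by rewrite emb_subst subst_comp; apply: subst_ext => x _ /=.
Qed.

Lemma inert_extend rho t : inert rho -> normal_form ER t ->
  (forall (f : S) a, t <> @Fun (sharp_sig R) (inl f) a) ->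
  exists rho', [/\ inert rho', extends rho rho' & exists x, rho' x = t].
Proof.
move=> rhoP nt tf; case: (pselect (exists x, rho x = t)) => [tx|ntx].
  by exists rho; split=> // x; exists x.
(* A new term takes index 0 and the old ones move up; it lies outside the range of [rho], which
   keeps the map injective. *)
exists (fun n => if n is m.+1 then rho m else t); split; last by exists 0.
  split.
  - case=> [|x] [|y] //= e.
    + by case: ntx; exists y.
    + by case: ntx; exists x.
    by rewrite (inert_inj rhoP e).
  - by case=> // x; apply: inert_normal rhoP x.
  by case=> // x; apply: inert_root rhoP x.
by move=> x; exists x.+1.
Qed.

(** Starting from an arbitrary [rho] allows several terms to be covered in turn by one
    substitution. *)
Definition coverable t : Prop := forall rho, inert rho ->
  exists rho', [/\ inert rho', extends rho rho' & exists w, subst rho' (emb w) = t].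

Lemma coverable_args n (a : 'I_n -> term (sharp_sig R)) rho :
  inert rho -> (forall i, coverable (a i)) ->
  exists rho' (b : 'I_n -> term S), [/\ inert rho', extends rho rho'
    & forall i, subst rho' (emb (b i)) = a i].
Proof.
move=> rhoP ca; suff H k : k <= n -> exists rho', [/\ inert rho', extends rho rho'
    & forall i : 'I_n, i < k -> exists w, subst rho' (emb w) = a i].
  have [rho' [rhoP' rr' h]] := H n (leqnn n).
  have /choice[b bE] : forall i, exists w, subst rho' (emb w) = a i by move=> i; apply: h.
  by exists rho', b.
elim: k => [_|k IH kn]; first by exists rho; split=> // x; exists x.
have [rho1 [rhoP1 rr1 h1]] := IH (ltnW kn).
have [rho2 [rhoP2 r12 h2]] := ca (Ordinal kn) rho1 rhoP1.
exists rho2; split=> // [x|i].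
  by have [y <-] := rr1 x; apply: r12.
rewrite ltnS leq_eqVlt => /orP[/eqP ik|/h1[w <-]]; last exact: extends_emb.
by have -> : i = Ordinal kn by apply: val_inj.
Qed.

Lemma coverable_Fun (f : S) (a : {ffun 'I_(arity f) -> term (sharp_sig R)}) :
  (forall i, coverable (a i)) -> coverable (@Fun (sharp_sig R) (inl f) a).
Proof.
move=> ca rho rhoP; have [rho' [b [rhoP' rr' bE]]] := coverable_args rhoP ca.
exists rho'; split=> //; exists (Fun f [ffun i => b i]) => /=.
by congr Fun; apply/ffunP => i; rewrite !ffunE.
Qed.

(** Variables and subterms rooted by a tuple symbol are put into the range of the substitution
    whole; other symbols are kept. *)
Lemma coverable_normal t : normal_form ER t -> coverable t.
Proof.
elim/term_ind': t => [x|[f|f] a IH] nt.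
- move=> rho rhoP; have [//|rho' [rhoP' rr' [y yE]]] := inert_extend rhoP nt.
  by exists rho'; split=> //; exists (Var y).
- apply: (@coverable_Fun f a) => i; apply: IH; apply: normal_subterm nt _.
  exact: (@subterm_arg (sharp_sig R) (a i) (inl f) a i (subterm_refl _)).
move=> rho rhoP; have [//|rho' [rhoP' rr' [y yE]]] := inert_extend rhoP nt.
by exists rho'; split=> //; exists (Var y).
Qed.

Lemma coverable_subst s w :
  (forall x, vars w x -> normal_form ER (s x)) -> coverable (subst s (emb w)).
Proof.
elim/term_ind': w => [x|f a IH] ns.
  by apply/coverable_normal/ns; rewrite /vars /= eqxx.
apply: (@coverable_Fun f) => i; rewrite !ffunE; apply: IH => x xi; apply: ns.
by apply/vars_arg; exists i.
Qed.

Lemma inert_Var : inert Var.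
Proof.
split=> [x y [] //|x v|//] /ctx_closureP[[l [r [s [lr]]]]|xv]; last by inversion xv.
by have [] := emb_trs_vars lr; case: l lr => [y _ []|//]; exists y.
Qed.

(** A single [rho] covering [t 0] serves the whole chain, since all later steps pull back along it.
    In the pulled-back chain tuple symbols occur only at the root, so arguments normal for [R] are
    also normal for [P]. *)
Lemma innermost_chain_abstract (t ss : nat -> term (sharp_sig R)) : minimal ER t ->
  (forall i, rt (below_root inn) (t i) (ss i.+1)) ->
  (forall i, root_step P (ss i) (t i) /\
     forall u, proper_subterm u (ss i) -> normal_form ER u) ->
  exists t' ss' : nat -> term (sharp_sig R),
    innermost_inf_chain P ER t' ss' /\ minimal ER t'.
Proof.
move=> tmin tss sst.
have [rho [f [a [rhoP t0E]]]] : exists rho f a, inert rho /\ t 0 = subst rho (sharp f a).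
  have [[l [r [s [lr s0E ->]]]] ns] := sst 0.
  have [f [g [a [b [r0 [fr gr [lE rE]]]]]]] := PDP lr; subst l r.
  have [|rho [b' [rhoP _ bE]]] :=
      @coverable_args _ (fun i => subst s (emb (b i))) _ inert_Var.
    move=> i; apply: coverable_subst => x xi; apply: ns.
    have /vars_arg[j xj] : vars (sharp f a) x.
      by apply: DP_vars fr gr _ _; rewrite vars_sharp; apply/vars_arg; exists i.
    rewrite s0E /=; apply: proper_subterm_arg (j) _; rewrite ffunE.
    exact: subst_var_subterm.
  exists rho, g, [ffun i => b' i]; split=> //=.
  by congr Fun; apply/ffunP => i; rewrite !ffunE bE.
(* States pair an index with the pulled-back term, so that dependent choice keeps track of the
   position in [t]. *)
pose lifted (p : nat * term (sharp_sig R)) :=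
  exists2 h : {f : tuple_sym R & {ffun 'I_(arity (sval f)) -> term S}},
    p.2 = sharp (projT1 h) (projT2 h) & t p.1 = subst rho p.2.
pose next (p q : nat * term (sharp_sig R)) := q.1 = p.1.+1 /\
  exists v, rt (below_root inn) p.2 v /\ innermost_root_step P (P `|` ER) v q.2.
have [||c [c0 cl cn]] := @dep_choice _ lifted next (0, sharp f a).
- by exists (existT _ f a).
- move=> [i _] [[g b] /= -> tiE].
  have := tss i; rewrite tiE => /(inert_below rhoP)[d bd sE].
  have [dt nd] := sst i.+1; rewrite sE in dt nd.
  have [h [e [de teE]]] := inert_dp_step rhoP dt.
  exists (i.+1, sharp h e); first by exists (existT _ h e).
  split=> //; exists (sharp g d); split=> //; split=> // v vd.
  have nv : normal_form ER v.
    by apply: (@inert_reflects_normal rho); apply: nd; apply: proper_subterm_subst.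
  move: vd nv => /proper_subterm_inv[j]; rewrite ffunE => /subterm_emb[w ->].
  exact: emb_normal_union.
have c1 i : (c i).1 = i by elim: i => [|i IH]; [rewrite c0|rewrite (cn i).1 IH].
have /choice[ss' ss'P] i := (cn i).2.
(* [ss' i] is the redex leading from [c i] to [c i.+1], whereas a chain stores it at index
   [i.+1]. *)
exists (fun i => (c i).2), (fun i => ss' i.-1); split=> [i|].
  exact: ss'P.
(* An infinite reduction from [u] would, under [rho], give one from a proper subterm of [t i]. *)
move=> i u ui [d [d0 dstep]].
have [_ _ tiE] := cl i; rewrite c1 in tiE.
apply: (tmin i (subst rho u)); first by rewrite tiE; apply: proper_subterm_subst.
exists (fun n => subst rho (d n)); rewrite d0; split=> // n.
exact: (ctx_subst (@root_step_subst _ _ rho) (dstep n)).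
Qed.

End Sharp.

Theorem theorem9 (S : signature) (R : set (rule S))
    (P : set (rule (sharp_sig R)))
    (trsR : is_trs R)
    (PDP : P `<=` DP R)
    (rlin : right_linear (emb_trs R `|` P))
    (over : overlay (emb_trs R `|` P)) :
  (~ exists t s : nat -> term (sharp_sig R),
       inf_chain P (emb_trs R) t s /\ minimal (emb_trs R) t)
  <->
  (~ exists t s : nat -> term (sharp_sig R),
       innermost_inf_chain P (emb_trs R) t s /\ minimal (emb_trs R) t).
Proof.
split=> nch [t [s [ts tmin]]]; apply: nch.
  exists t, s; split=> // i; have [h1 [h2 _]] := ts i; split=> //.
  apply: rt_sub h1 => u v; apply: below_root_sub => u' v'.
  exact: innermost_step_step.
have t0c : starts_chain (emb_trs R) P (t 0) by exists t, s.
have [t' [ss [t'min t'ss sst']]] :=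
  innermost_chain_exists (sharp_trs trsR PDP) rlin over (sharp_rhs PDP) t0c.
exact: (innermost_chain_abstract trsR PDP t'min t'ss sst').
Qed.
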